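(* Let $X$ be a right-continuous real valued stochastic process. Then, with probability $1$, $$\left\{(t,X_t):t\in\mathbb{R}_+\right\}\subseteq\mathrm{MSupp}(X).$$
   Context: The process $X$ is indexed by $\mathbb{R}_+=[0,\infty)$; right-continuous means that its sample paths are right-continuous. Support: for a real valued random variable $V$, $\mathrm{Supp}(V)$ is the smallest closed subset of $\mathbb{R}$ with $\mathbb{P}(V\in\mathrm{Supp}(V))=1$. Marginal support: $\mathrm{MSupp}(X)=\{(t,x)\in\mathbb{R}_+\times\mathbb{R}: x\in\mathrm{Supp}(X_t)\}$. *)

(* Defs.v *)
From HB Require Import structures.
From mathcomp Require Import all_boot all_order all_algebra.
From mathcomp Require Import all_classical all_reals all_analysis.

Set Implicit Arguments.
Unset Strict Implicit.
Unset Printing Implicit Defensive.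

Import Order.TTheory GRing.Theory Num.Theory.
Import numFieldNormedType.Exports.

Local Open Scope classical_set_scope.
Local Open Scope ring_scope.

(* The index set [0, +oo), as a type carrying the topology induced by R. *)
Notation Rplus R := (set_type [set t : R | 0 <= t]).

(* [smallest] is by definition an intersection; [closed_supp],
   [probability_supp] and [supp_sub] below show that it is attained. *)
Definition supp (R : realType) (d : measure_display) (T : measurableType d)
    (P : probability T R) (V : {RV P >-> R}) : set R :=
  smallest (fun C : set R => closed C /\ P (V @^-1` C) = 1%E) set0.

Definition msupp (R : realType) (d : measure_display) (T : measurableType d)
    (P : probability T R) (X : Rplus R -> {RV P >-> R}) : set (Rplus R * R) :=
  [set tx | supp (X tx.1) tx.2].

(* The filter is the analogue on [0, +oo) of the library's [at_right]. *)
Definition right_continuous_path (R : realType) (f : Rplus R -> R) : Prop :=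
  forall t : Rplus R,
    f @ within [set s : Rplus R | \val t < \val s] (nbhs t) --> f t.

Section supp_theory.
Context (R : realType) (d : measure_display) (T : measurableType d).
Context (P : probability T R) (V : {RV P >-> R}).

Lemma closed_supp : closed (supp V).
Proof. by apply: closed_bigI => C [[]]. Qed.

Lemma supp_sub (C : set R) :
  closed C -> P (V @^-1` C) = 1%E -> supp V `<=` C.
Proof. by move=> cC PC; apply: smallest_sub. Qed.

Lemma probability_supp : P (V @^-1` supp V) = 1%E.
Proof.
have mV (A : set R) : measurable A -> measurable (V @^-1` A).
  by move=> mA; rewrite -[X in measurable X]setTI; apply: measurable_funP.
pose J (k : rat * rat) : set R := `]ratr k.1, ratr k.2[%classic.
have mJ k : measurable (V @^-1` J k) by apply: mV; exact: measurable_itv.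
pose F (n : nat) : set T :=
  if unpickle n is Some k then
    if P (V @^-1` J k) == 0%E then V @^-1` J k else set0
  else set0.
have negF n : P.-negligible (F n).
  rewrite /F; case: unpickle => [k|]; last exact: negligible_set0.
  case: eqP => [Pk|_]; last exact: negligible_set0.
  by exists (V @^-1` J k); split => //; exact: mJ.
have subF k : P (V @^-1` J k) = 0%E -> V @^-1` J k `<=` F (pickle k).
  by move=> Pk; rewrite /F pickleK Pk eqxx.
clearbody F.
have mS : measurable (V @^-1` supp V).
  by apply: mV; apply: measurable_realfun.closed_measurable; exact: closed_supp.
have : P.-negligible (~` (V @^-1` supp V)).
  apply: negligibleS (negligible_bigcup negF) => w /= Sw.
  have [C [[cC PC] nC]] :
      exists C : set R, (closed C /\ P (V @^-1` C) = 1%E) /\ ~ C (V w).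
    apply: contrapT => h; apply: Sw => C [[cC PC] _].
    by apply: contrapT => nC; apply: h; exists C.
  have /nbhs_ballP[e /= e0 eC] : nbhs (V w) (~` C).
    by apply: open_nbhs_nbhs; split => //; exact: closed_openC.
  have [p] : exists p : rat, ratr p \in `]V w - e, V w[.
    by apply: rat_in_itvoo; rewrite ltrBlDr ltrDl.
  rewrite in_itv /= => /andP[p1 p2].
  have [q] : exists q : rat, ratr q \in `]V w, V w + e[.
    by apply: rat_in_itvoo; rewrite ltrDl.
  rewrite in_itv /= => /andP[q1 q2].
  have mC : measurable (V @^-1` C).
    by apply: mV; exact: measurable_realfun.closed_measurable.
  have PI0 : P (V @^-1` J (p, q)) = 0%E.
    apply/eqP; rewrite -measure_le0.
    have <- : P (~` (V @^-1` C)) = 0%E.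
      by rewrite probability_setC // PC subee.
    apply: le_measure; rewrite ?inE //; first exact: measurableC.
    move=> v /=; rewrite /J /= in_itv /= => /andP[v1 v2]; apply: eC.
    by rewrite /ball /= ltr_distlC (lt_trans p1 v1) (lt_trans v2 q2).
  exists (pickle (p, q)); first exact: I.
  by apply: (subF _ PI0); rewrite /J /= in_itv /= p2 q1.
move/(measure_negligible (measurableC mS)) => h.
by move: (probability_setC P (measurableC mS)); rewrite setCK h sube0.
Qed.

End supp_theory.

(* Main.v *)
Require Import Defs.
From HB Require Import structures.
From mathcomp Require Import all_boot all_order all_algebra.
From mathcomp Require Import all_classical all_reals all_analysis.
Import Order.TTheory GRing.Theory Num.Theory.
Import numFieldNormedType.Exports.
Local Open Scope classical_set_scope.
Local Open Scope ring_scope.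

(** At each fixed time [X t] lies in its support almost surely; the difficulty
    is that uncountably many times have to be handled at once.

    If [X t w] lies outside the support of [X t], then some open interval [J]
    with rational endpoints contains [X t w] and is not charged by the law of
    [X t] ([null_interval_off_supp]).  There are countably many such [J], so it
    is enough to fix [J], put [A := {t | P (X t \in J) = 0}], and show that
    almost surely [X] is never in [J] at a time of [A]
    ([negligible_visit_null_open]).

    By right-continuity, a path that is in [J] at time [t] stays there during
    some interval [[t, b[] ([right_continuous_stays]).  Now every set of reals,
    however irregular, has a countable subset [D] that meets [[t, b[] for
    all of its points [t] and all [b > t] ([countable_dense_from_right]: the
    Sorgenfrey line is hereditarily separable).  Hence a path which visits [J]
    at a time of [A] also does so at a time of [D].  Since [D] is countable and
    contained in [A], this happens with probability zero. *)

Lemma negligible_bigcup_countable (d : measure_display) (T : measurableType d)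
    (R : realType) (mu : {measure set T -> \bar R}) (I : Type) (D : set I)
    (F : I -> set T) :
  countable D -> (forall i, D i -> mu.-negligible (F i)) ->
  mu.-negligible (\bigcup_(i in D) F i).
Proof.
move=> /pfcard_geP[->|[g]] negF.
  by rewrite bigcup_set0; exact: negligible_set0.
apply: (@negligibleS _ _ _ _ (\bigcup_n F (g n))).
  by move=> w [i /(@surj _ _ _ _ g)[n _ <-] Fw]; exists n.
by apply: negligible_bigcup => n; apply: negF; exact: funS.
Qed.

(** Countable choice, one point in each nonempty [B k], packaged so that no
    default element of [I] is called for. *)
Lemma countable_transversal (K : countType) (I : Type) (B : K -> set I) :
  exists D : set I, [/\ countable D, D `<=` \bigcup_k B k &
    forall k, B k !=set0 -> D `&` B k !=set0].
Proof.
pose pt k :=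
  if pselect (B k !=set0) is left h then [set projT1 (cid h)] else set0.
have ptB k : pt k `<=` B k.
  rewrite /pt; case: pselect => [h|_] // i ->.
  exact: (projT2 (cid h)).
exists (\bigcup_k pt k); split.
- apply: bigcup_countable; first exact: countableP.
  by move=> k _; rewrite /pt; case: pselect => // h; exact: countable1.
- by move=> i [k _ /ptB Bi]; exists k.
- move=> k Bk; have [i pti] : pt k !=set0.
    by rewrite /pt; case: pselect => // h; exists (projT1 (cid h)).
  by exists i; split; [exists k|exact: ptB].
Qed.

(** Hereditary separability of the Sorgenfrey line, for a set [A] carried to the
    reals by [f].  A point of [A] inside each rational interval is enough,
    except for the times [t] of [A] followed by a gap of [A]: such a [t] is the
    largest point of [A] below some rational [q], so one further point for each
    [q] takes care of them. *)
Lemma countable_dense_from_right (R : realType) (I : Type) (f : I -> R)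
    (A : set I) :
  exists D : set I, [/\ countable D, D `<=` A &
    forall t b, A t -> f t < b -> exists s, [/\ D s, f t <= f s & f s < b]].
Proof.
pose B (k : (rat * rat) + rat) : set I :=
  match k with
  | inl (p, q) => [set s | A s /\ ratr p < f s < ratr q]
  | inr q => [set s | [/\ A s, f s < ratr q &
                         forall u, A u -> f u < ratr q -> f u <= f s]]
  end.
have [D [cD DB Dmeet]] := countable_transversal _ _ B.
exists D; split => //.
  by move=> s /DB[[[p q]|q] _] /= [].
move=> t b At tb.
have [q] := rat_in_itvoo tb; rewrite in_itv /= => /andP[tq qb].
have [tmax|] := pselect (forall u, A u -> f u < ratr q -> f u <= f t).
  have [|s [Ds [_ sq smax]]] := Dmeet (inr q); first by exists t.
  by exists s; split => //; [exact: smax|exact: lt_trans qb].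
move=> /existsNP[u /not_implyP[Au /not_implyP[uq /negP]]].
rewrite -ltNge => tu.
have [p] := rat_in_itvoo tu; rewrite in_itv /= => /andP[tp pu].
have [|s [Ds [_ /andP[ps sq]]]] := Dmeet (inl (p, q)).
  by exists u; split => //; rewrite pu.
exists s; split => //; last exact: lt_trans qb.
exact/ltW/(lt_trans tp).
Qed.

(** Right-continuity speaks only of times strictly after [t]; the time [t]
    itself is put back by the hypothesis [U (f t)], which yields a half-open
    interval of the form used by [countable_dense_from_right]. *)
Lemma right_continuous_stays (R : realType) (f : Rplus R -> R) (U : set R)
    (t : Rplus R) :
  right_continuous_path f -> open U -> U (f t) ->
  exists2 b : R, \val t < b &
    forall s : Rplus R, \val t <= \val s -> \val s < b -> U (f s).
Proof.
move=> rcf oU Uft.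
(* The topology of the half-line is induced by [\val], so a neighborhood of
   [t] contains the trace [V] of an open set [W] of reals. *)
have := rcf t U (open_nbhs_nbhs (conj oU Uft)).
rewrite /nbhs /= /within /= => -[V [[W oW WV] Vt VU]].
have [e /= e0 eW] : nbhs (\val t) W.
  by apply: open_nbhs_nbhs; split => //; rewrite -WV in Vt.
exists (\val t + e); first by rewrite ltrDl.
move=> s; rewrite le_eqVlt => /orP[/eqP /val_inj <- //|ts] se.
apply: (VU s) => //; rewrite -WV; apply: eW => /=.
by rewrite ltr0_norm ?subr_lt0// opprB ltrBlDl.
Qed.

Lemma measurable_RV_preimage (R : realType) (d : measure_display)
    (T : measurableType d) (P : probability T R) (V : {RV P >-> R})
    (A : set R) :
  measurable A -> measurable (V @^-1` A).
Proof.
by move=> mA; rewrite -[X in measurable X]setTI; exact: measurable_funP.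
Qed.

(** The uncountable union over [t] is controlled by a countable one: a path in
    [U] at a null time [t] is still in [U] at some null time of a fixed
    countable set, chosen independently of the path. *)
Lemma negligible_visit_null_open (R : realType) (d : measure_display)
    (T : measurableType d) (P : probability T R) (X : Rplus R -> {RV P >-> R})
    (U : set R) :
  (forall w, right_continuous_path (fun t => X t w)) -> open U ->
  P.-negligible [set w | exists t, P (X t @^-1` U) = 0%E /\ U (X t w)].
Proof.
move=> rcX oU.
pose A := [set t | P (X t @^-1` U) = 0%E].
have [D [cD DA Dright]] :=
  countable_dense_from_right R _ (\val : Rplus R -> R) A.
apply: (@negligibleS _ _ _ _ (\bigcup_(s in D) X s @^-1` U)).
  move=> w [t [At Ut]].
  have [b tb stay] := right_continuous_stays R _ U t (rcX w) oU Ut.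
  have [s [Ds ts sb]] := Dright t b At tb.
  by exists s => //; exact: stay.
apply: negligible_bigcup_countable => // s /DA As.
exists (X s @^-1` U); split => //; apply: measurable_RV_preimage.
exact: measurable_realfun.open_measurable.
Qed.

(** Rational endpoints leave only countably many ways to be off the support,
    whatever the random variable.  The interval is null because it avoids the
    support, which has full probability. *)
Lemma null_interval_off_supp (R : realType) (d : measure_display)
    (T : measurableType d) (P : probability T R) (V : {RV P >-> R}) (x : R) :
  ~ supp V x -> exists k : rat * rat,
    P (V @^-1` `]ratr k.1, ratr k.2[) = 0%E /\ `]ratr k.1, ratr k.2[%classic x.
Proof.
move=> nSx.
have /nbhs_ballP[e /= e0 eS] : nbhs x (~` supp V).
  apply: open_nbhs_nbhs; split => //; apply: closed_openC.
  exact: closed_supp.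
have [p] : exists p : rat, ratr p \in `]x - e, x[.
  by apply: rat_in_itvoo; rewrite ltrBlDr ltrDl.
rewrite in_itv /= => /andP[ep px].
have [q] : exists q : rat, ratr q \in `]x, x + e[.
  by apply: rat_in_itvoo; rewrite ltrDl.
rewrite in_itv /= => /andP[xq qe].
exists (p, q); split; last by rewrite /= in_itv /= px.
have mS : measurable (V @^-1` supp V).
  apply: measurable_RV_preimage; apply: measurable_realfun.closed_measurable.
  exact: closed_supp.
have PSC : P (~` (V @^-1` supp V)) = 0%E.
  by rewrite probability_setC// probability_supp subee.
apply/eqP; rewrite -measure_le0 -PSC; apply: le_measure; rewrite ?inE.
- by apply: measurable_RV_preimage; exact: measurable_itv.
- exact: measurableC.
- move=> w; rewrite /= in_itv /= => /andP[pw wq]; apply: eS.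
  by rewrite /ball /= ltr_distlC (lt_trans ep pw) (lt_trans wq qe).
Qed.

Theorem lemma4p3 (R : realType) (d : measure_display) (T : measurableType d)
    (P : probability T R) (X : Rplus R -> {RV P >-> R})
    (rcX : forall w : T, right_continuous_path (fun t => X t w)) :
  {ae P, forall w : T, [set (t, X t w) | t in [set: Rplus R]] `<=` msupp X}.
Proof.
pose N (k : rat * rat) := [set w | exists t : Rplus R,
  P (X t @^-1` `]ratr k.1, ratr k.2[) = 0%E /\
  `]ratr k.1, ratr k.2[%classic (X t w)].
apply: (@negligibleS _ _ _ _ (\bigcup_k N k)).
  move=> w /= /existsNP[_ /not_implyP[[t _ <-]]].
  by move=> /null_interval_off_supp[k ?]; exists k => //; exists t.
apply: negligible_bigcup_countable; first exact: countableP.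
by move=> k _; apply: negligible_visit_null_open => //; exact: itv_open.
Qed.
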